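(* Let $R$ be a commutative ring with $1$ and let $E$ be a row-finite directed graph with $C_u(E)=\varnothing$ (equivalently, $E$ satisfies Condition (K)). Let $I\trianglelefteq L_R(E)$ be an ideal corresponding to the saturated function $f\in\mathscr{F}_{E,R}$. If $I$ is prime, then $f$ takes values in $\operatorname{Spec}(R)\cup\{R\}$.
   Context: A directed graph $E=(E^0,E^1,r,s)$ has vertices $E^0$, edges $E^1$, range and source maps $r,s:E^1\to E^0$; it is row-finite if $s^{-1}(v)$ is finite for every $v$. A vertex $v$ is regular if $s^{-1}(v)$ is finite and nonempty. A path of positive length is $e_1\cdots e_n$ with $r(e_i)=s(e_{i+1})$; vertices are paths of length $0$. A path with $n>0$ is closed if $s(e_1)=r(e_n)$; a closed path is simple if $s(e_i)=s(e_1)$ implies $i=1$, and a cycle if $s(e_i)=s(e_j)$ implies $i=j$. $C_u(E)$ is the set of (rotation classes of) cycles $c$ such that there is exactly one closed simple path based at $s(c)=r(c)$. $L_R(E)$, the Leavitt path algebra, is the universal associative $R$-algebra generated by $E^0\cup E^1\cup\{e^*\mid e\in E^1\}$ subject to: $vw=\delta_{vw}v$; $s(e)e=e=er(e)$; $r(e)e^*=e^*=e^*s(e)$; $e^*f=\delta_{ef}r(e)$; $u=\sum_{e\in s^{-1}(u)}ee^*$ for regular $u$. Ideals are two-sided. An ideal $P$ of a ring $A$ is prime if $P\ne A$ and $AB$-type products detect it: for ideals $I_1,I_2$ of $A$, $I_1I_2\subseteq P$ implies $I_1\subseteq P$ or $I_2\subseteq P$. $\operatorname{Spec}(R)$ is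 the set of prime ideals of $R$. $H\subseteq E^0$ is hereditary if for every path $\mu$, $s(\mu)\in H$ implies $r(\mu)\in H$; saturated if for every regular $v$, $r(s^{-1}(v))\subseteq H$ implies $v\in H$. Since $E$ is row-finite, $\mathscr{T}_E$ is the complete lattice of hereditary saturated subsets of $E^0$ under inclusion, $\mathscr{T}_E^*=\mathscr{T}_E\setminus\{\varnothing\}$, and $\mathscr{F}_{E,R}$ (the saturated functions) is the set of functions $f$ from $\mathscr{T}_E^*$ to the ideals of $R$ with $f(\bigvee_iH_i)=\bigcap_if(H_i)$ for all nonempty families in $\mathscr{T}_E^*$. The saturated function corresponding to an ideal $I$ of $L_R(E)$ is $f(H)=\{r\in R\mid rv\in I\text{ for all }v\in H\}$. *)

(* Defs.v *)
From HB Require Import structures.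
From mathcomp Require Import all_boot all_algebra finmap generic_quotient.
From mathcomp Require Import mathcomp_extra boolp classical_sets functions.
From mathcomp Require Import cardinality fsbigop.

Set Implicit Arguments.
Unset Strict Implicit.
Unset Printing Implicit Defensive.

Import GRing.Theory.
Local Open Scope classical_set_scope.
Local Open Scope quotient_scope.
Local Open Scope ring_scope.

(* L_R(E) has no unit when E has infinitely many vertices, and MathComp has   *)
(* no structure for non-unital rings: the ideal theory below is stated for an *)
(* additive group A with an explicit product mul, to be used both with a      *)
(* commutative ring (mul := *%R) and with L_R(E) (mul := lpa_mul).            *)

Section Ideals.
Variables (A : zmodType) (mul : A -> A -> A).

Definition ideal (I : set A) : Prop :=
  [/\ I 0, forall x y, I x -> I y -> I (x - y),
      forall a x, I x -> I (mul a x) & forall a x, I x -> I (mul x a)].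

Definition ideals : set (set A) := [set I | ideal I].

Definition ideal_prod (I J : set A) : set A :=
  [set x | exists2 s : seq (A * A),
     forall p, p \in s -> I p.1 /\ J p.2 & x = \sum_(p <- s) mul p.1 p.2].

Definition prime_ideal (P : set A) : Prop :=
  [/\ ideal P, P <> setT &
      forall I J, ideal I -> ideal J -> ideal_prod I J `<=` P ->
        I `<=` P \/ J `<=` P].

End Ideals.

Definition Spec (R : comPzRingType) : set (set R) :=
  [set P | prime_ideal *%R P].
Arguments Spec : clear implicits.

(* By choice every type is a choiceType (see {classic T} in boolp), so asking *)
(* for choiceTypes of vertices and edges is no restriction.                   *)
Record graph := Graph {
  vertex : choiceType;
  edge : choiceType;
  src : edge -> vertex;
  rng : edge -> vertex }.

Section Graphs.
Variable E : graph.
Implicit Types (u v : vertex E) (e : edge E) (p : seq (edge E)).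

Definition out v : set (edge E) := [set e | src e = v].

Definition row_finite : Prop := forall v, finite_set (out v).

Definition regular v : Prop := finite_set (out v) /\ out v !=set0.

(* A path is encoded by its source v and the sequence p of its edges; the     *)
(* path of length 0 at v is given by p = [::].                                *)
Fixpoint is_path v p : bool :=
  if p is e :: p' then (src e == v) && is_path (rng e) p' else true.

Definition path_rng v p : vertex E := last v (map (@rng E) p).

Definition closed_path v p : Prop :=
  [/\ is_path v p, p != [::] & path_rng v p = v].

Definition path_src v p (i : nat) : vertex E := nth v (map (@src E) p) i.

Definition closed_simple_path v p : Prop :=
  closed_path v p /\
  forall i, (i < size p)%N -> path_src v p i = path_src v p 0%N -> i = 0%N.

Definition cycle_at v p : Prop :=
  closed_path v p /\
  forall i j, (i < size p)%N -> (j < size p)%N ->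
    path_src v p i = path_src v p j -> i = j.

Definition rotation_class p : set (seq (edge E)) := [set rot i p | i in setT].

Definition C_u : set (set (seq (edge E))) :=
  [set rotation_class c | c in
     [set c | exists v, cycle_at v c /\ exists! p, closed_simple_path v p]].

Definition hereditary (H : set (vertex E)) : Prop :=
  forall v p, is_path v p -> H v -> H (path_rng v p).

Definition saturated (H : set (vertex E)) : Prop :=
  forall v, regular v -> @rng E @` out v `<=` H -> H v.

(* The lattice T_E of a row-finite graph, and T_E^*. *)
Definition T_ : set (set (vertex E)) :=
  [set H | hereditary H /\ saturated H].

Definition Tstar : set (set (vertex E)) := T_ `\ set0.

Definition T_join (F : set (set (vertex E))) : set (vertex E) :=
  \bigcap_(K in [set K | T_ K /\ forall H, F H -> H `<=` K]) K.

Lemma T_joinP F : T_ (T_join F).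
Proof.
split=> [v p vp Fv K [TK FK]|v vreg vF K [TK FK]]; have [hK sK] := TK.
  by apply: hK => //; apply: Fv; split.
by apply: sK => // w /vF; apply; split.
Qed.

Definition Tstar_set (F : set Tstar) : set (set (vertex E)) :=
  [set set_val H | H in F].

Lemma Tstar_joinP (F : set Tstar) (F0 : F !=set0) :
  T_join (Tstar_set F) \in Tstar.
Proof.
rewrite inE; split; first exact: T_joinP.
case: F0 => H FH /= J0; have [_ H0] : Tstar (set_val H) by exact: set_valP.
apply: H0; apply/seteqP; split=> // v Hv; rewrite -J0 => K [_].
by apply; [exists H|exact: Hv].
Qed.

Definition Tstar_join (F : set Tstar) (F0 : F !=set0) : Tstar :=
  exist _ (T_join (Tstar_set F)) (Tstar_joinP F0).

End Graphs.

Arguments C_u : clear implicits.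
Arguments T_ : clear implicits.
Arguments Tstar : clear implicits.

(* The saturated functions, i.e. the elements of F_{E,R}. *)
Definition saturated_function (E : graph) (R : comPzRingType)
    (f : Tstar E -> ideals ( *%R : R -> R -> R)) : Prop :=
  forall (F : set (Tstar E)) (F0 : F !=set0),
    set_val (f (Tstar_join F0)) = \bigcap_(H in F) set_val (f H).

(* Associative, not necessarily unital, R-algebra structures on an R-module. *)
Definition algebra_law (R : comPzRingType) (A : lmodType R)
    (mul : A -> A -> A) : Prop :=
  [/\ associative mul, left_distributive mul +%R,
      right_distributive mul +%R,
      forall k a b, mul (k *: a) b = k *: mul a b &
      forall k a b, mul a (k *: b) = k *: mul a b].

Definition leavitt_family (E : graph) (R : comPzRingType) (A : lmodType R)
    (mul : A -> A -> A) (V : vertex E -> A) (X Y : edge E -> A) : Prop :=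
  (forall v w, mul (V v) (V w) = if v == w then V v else 0) /\
  (forall e, [/\ mul (V (src e)) (X e) = X e, mul (X e) (V (rng e)) = X e,
                 mul (V (rng e)) (Y e) = Y e & mul (Y e) (V (src e)) = Y e]) /\
  (forall e g, mul (Y e) (X g) = if e == g then V (rng e) else 0) /\
  (forall u, regular u -> V u = \sum_(e \in out u) mul (X e) (Y e)).

Section LeavittPathAlgebra.
Variables (R : comPzRingType) (E : graph).

(* L_R(E) is the algebra of formal expressions in the generators, modulo the  *)
(* least congruence containing the axioms of R-algebras and the defining      *)
(* relations.                                                                 *)
Inductive term : Type :=
  | tvertex of vertex E
  | tedge of edge E
  | tghost of edge E
  | tzero
  | topp of term
  | tadd of term & term
  | tscale of R & term
  | tmul of term & term.

(* fset_set A enumerates A without repetition when A is finite. *)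
Inductive teq : term -> term -> Prop :=
  | teq_refl a : teq a a
  | teq_sym a b : teq a b -> teq b a
  | teq_trans a b c : teq a b -> teq b c -> teq a c
  | teq_opp a b : teq a b -> teq (topp a) (topp b)
  | teq_add a a' b b' : teq a a' -> teq b b' -> teq (tadd a b) (tadd a' b')
  | teq_scale k a b : teq a b -> teq (tscale k a) (tscale k b)
  | teq_mul a a' b b' : teq a a' -> teq b b' -> teq (tmul a b) (tmul a' b')
  | teq_addA a b c : teq (tadd a (tadd b c)) (tadd (tadd a b) c)
  | teq_addC a b : teq (tadd a b) (tadd b a)
  | teq_add0 a : teq (tadd tzero a) a
  | teq_addN a : teq (tadd (topp a) a) tzero
  | teq_scaleA k l a : teq (tscale k (tscale l a)) (tscale (k * l) a)
  | teq_scale1 a : teq (tscale 1 a) a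
  | teq_scaleDr k a b :
      teq (tscale k (tadd a b)) (tadd (tscale k a) (tscale k b))
  | teq_scaleDl k l a : teq (tscale (k + l) a) (tadd (tscale k a) (tscale l a))
  | teq_mulA a b c : teq (tmul a (tmul b c)) (tmul (tmul a b) c)
  | teq_mulDl a b c : teq (tmul (tadd a b) c) (tadd (tmul a c) (tmul b c))
  | teq_mulDr a b c : teq (tmul a (tadd b c)) (tadd (tmul a b) (tmul a c))
  | teq_scalel k a b : teq (tmul (tscale k a) b) (tscale k (tmul a b))
  | teq_scaler k a b : teq (tmul a (tscale k b)) (tscale k (tmul a b))
  | teq_vertex v w :
      teq (tmul (tvertex v) (tvertex w)) (if v == w then tvertex v else tzero)
  | teq_src_edge e : teq (tmul (tvertex (src e)) (tedge e)) (tedge e)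
  | teq_edge_rng e : teq (tmul (tedge e) (tvertex (rng e))) (tedge e)
  | teq_rng_ghost e : teq (tmul (tvertex (rng e)) (tghost e)) (tghost e)
  | teq_ghost_src e : teq (tmul (tghost e) (tvertex (src e))) (tghost e)
  | teq_ghost_edge e g :
      teq (tmul (tghost e) (tedge g))
          (if e == g then tvertex (rng e) else tzero)
  | teq_regular u : regular u ->
      teq (tvertex u)
          (\big[tadd/tzero]_(e <- fset_set (out u)) tmul (tedge e) (tghost e)).

HB.instance Definition _ := gen_eqMixin term.
HB.instance Definition _ := gen_choiceMixin term.

Let teqb (a b : term) : bool := `[< teq a b >].

Lemma teqb_refl : reflexive teqb.
Proof. by move=> a; apply/asboolP; exact: teq_refl. Qed.

Lemma teqb_sym : symmetric teqb.
Proof. by move=> a b; apply/asboolP/asboolP; apply: teq_sym. Qed.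

Lemma teqb_trans : transitive teqb.
Proof.
by move=> b a c /asboolP ab /asboolP bc; apply/asboolP; exact: teq_trans bc.
Qed.

Canonical teq_equiv := EquivRel teqb teqb_refl teqb_sym teqb_trans.

Definition lpa : Type := {eq_quot teq_equiv}.
HB.instance Definition _ := Choice.on lpa.

Definition cls (a : term) : lpa := \pi_({eq_quot teq_equiv}) a.

Lemma clsP a b : cls a = cls b <-> teq a b.
Proof. by split=> [/eqmodP/asboolP//|ab]; apply/eqmodP/asboolP. Qed.

Lemma clsK x : cls (repr x) = x.
Proof. exact: reprK. Qed.

Lemma teq_repr a : teq (repr (cls a)) a.
Proof. by apply/clsP; rewrite clsK. Qed.

Lemma lpaW (P : lpa -> Prop) : (forall a, P (cls a)) -> forall x, P x.
Proof. by move=> Pc x; rewrite -(clsK x). Qed.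

Let addL (x y : lpa) : lpa := cls (tadd (repr x) (repr y)).
Let oppL (x : lpa) : lpa := cls (topp (repr x)).
Let scaleL (k : R) (x : lpa) : lpa := cls (tscale k (repr x)).
Definition lpa_mul (x y : lpa) : lpa := cls (tmul (repr x) (repr y)).

Let addLE a b : addL (cls a) (cls b) = cls (tadd a b).
Proof. by apply/clsP/teq_add; exact: teq_repr. Qed.

Let oppLE a : oppL (cls a) = cls (topp a).
Proof. by apply/clsP/teq_opp; exact: teq_repr. Qed.

Let scaleLE k a : scaleL k (cls a) = cls (tscale k a).
Proof. by apply/clsP/teq_scale; exact: teq_repr. Qed.

Lemma lpa_mulE a b : lpa_mul (cls a) (cls b) = cls (tmul a b).
Proof. by apply/clsP/teq_mul; exact: teq_repr. Qed.

Let addLA : associative addL.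
Proof.
elim/lpaW=> a; elim/lpaW=> b; elim/lpaW=> c.
by rewrite !addLE; apply/clsP/teq_addA.
Qed.

Let addLC : commutative addL.
Proof.
by elim/lpaW=> a; elim/lpaW=> b; rewrite !addLE; apply/clsP/teq_addC.
Qed.

Let add0L : left_id (cls tzero) addL.
Proof. by elim/lpaW=> a; rewrite !addLE; apply/clsP/teq_add0. Qed.

Let addNL : left_inverse (cls tzero) oppL addL.
Proof. by elim/lpaW=> a; rewrite oppLE addLE; apply/clsP/teq_addN. Qed.

HB.instance Definition _ := GRing.isZmodule.Build lpa addLA addLC add0L addNL.

Let scaleLA k l x : scaleL k (scaleL l x) = scaleL (k * l) x.
Proof. by elim/lpaW: x => a; rewrite !scaleLE; apply/clsP/teq_scaleA. Qed.

Let scaleL1 : left_id 1 scaleL.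
Proof. by elim/lpaW=> a; rewrite !scaleLE; apply/clsP/teq_scale1. Qed.

Let scaleLDr : right_distributive scaleL +%R.
Proof.
move=> k; elim/lpaW=> a; elim/lpaW=> b.
rewrite (scaleLE k a) (scaleLE k b) -[RHS]/(addL _ _).
rewrite -[X in scaleL _ X]/(addL _ _) !addLE scaleLE.
exact/clsP/teq_scaleDr.
Qed.

Let scaleLDl x : {morph scaleL^~ x : k l / k + l}.
Proof.
move=> k l; elim/lpaW: x => a; rewrite !scaleLE -[RHS]/(addL _ _) addLE.
exact/clsP/teq_scaleDl.
Qed.

HB.instance Definition _ :=
  GRing.Zmodule_isLmodule.Build R lpa scaleLA scaleL1 scaleLDr scaleLDl.

Lemma lpa_zeroE : 0 = cls tzero. Proof. by []. Qed.

Lemma lpa_oppE a : - cls a = cls (topp a). Proof. exact: oppLE. Qed.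

Lemma lpa_addE a b : cls a + cls b = cls (tadd a b). Proof. exact: addLE. Qed.

Lemma lpa_scaleE k a : k *: cls a = cls (tscale k a).
Proof. exact: scaleLE. Qed.

Definition lpa_vertex (v : vertex E) : lpa := cls (tvertex v).
Definition lpa_edge (e : edge E) : lpa := cls (tedge e).
Definition lpa_ghost (e : edge E) : lpa := cls (tghost e).

Lemma lpa_algebra : algebra_law lpa_mul.
Proof.
split=> [||| k|k].
- elim/lpaW=> a; elim/lpaW=> b; elim/lpaW=> c; rewrite !lpa_mulE.
  exact/clsP/teq_mulA.
- elim/lpaW=> a; elim/lpaW=> b; elim/lpaW=> c.
  by rewrite lpa_addE !lpa_mulE lpa_addE; apply/clsP/teq_mulDl.
- elim/lpaW=> a; elim/lpaW=> b; elim/lpaW=> c.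
  by rewrite lpa_addE !lpa_mulE lpa_addE; apply/clsP/teq_mulDr.
- elim/lpaW=> a; elim/lpaW=> b.
  by rewrite lpa_mulE !lpa_scaleE lpa_mulE; apply/clsP/teq_scalel.
- elim/lpaW=> a; elim/lpaW=> b.
  by rewrite lpa_mulE !lpa_scaleE lpa_mulE; apply/clsP/teq_scaler.
Qed.

Lemma lpa_leavitt : leavitt_family lpa_mul lpa_vertex lpa_edge lpa_ghost.
Proof.
split=> [v w|]; last split=> [e|]; last split=> [e g|u ureg].
- rewrite lpa_mulE /lpa_vertex lpa_zeroE -(fun_if cls).
  exact/clsP/teq_vertex.
- split; rewrite lpa_mulE; apply/clsP.
  + exact: teq_src_edge.
  + exact: teq_edge_rng.
  + exact: teq_rng_ghost.
  + exact: teq_ghost_src.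
- rewrite lpa_mulE /lpa_vertex lpa_zeroE -(fun_if cls).
  exact/clsP/teq_ghost_edge.
- rewrite fsbig_finite; last by case: ureg.
  have -> : lpa_vertex u = cls (\big[tadd/tzero]_(e <- fset_set (out u))
      tmul (tedge e) (tghost e)) by apply/clsP/teq_regular.
  elim/big_rec2: _ => // e x y _ <-.
  by rewrite -lpa_addE lpa_mulE.
Qed.

(* The universal property of L_R(E). *)
Section Universal.
Variables (A : lmodType R) (mul : A -> A -> A).
Variables (V : vertex E -> A) (X Y : edge E -> A).
Hypotheses (algA : algebra_law mul) (VXY : leavitt_family mul V X Y).

Fixpoint eval (a : term) : A :=
  match a with
  | tvertex v => V v
  | tedge e => X e
  | tghost e => Y e
  | tzero => 0
  | topp a => - eval a
  | tadd a b => eval a + eval b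
  | tscale k a => k *: eval a
  | tmul a b => mul (eval a) (eval b)
  end.

Lemma eval_teq a b : teq a b -> eval a = eval b.
Proof.
case: algA => mA mDl mDr ml mr; case: VXY => V1 [V2 [V3 V4]].
elim=> //=.
- by move=> {}a {}b c _ -> _ ->.
- by move=> {}a {}b _ ->.
- by move=> a1 a2 b1 b2 _ -> _ ->.
- by move=> k {}a {}b _ ->.
- by move=> a1 a2 b1 b2 _ -> _ ->.
- by move=> *; rewrite addrA.
- by move=> *; rewrite addrC.
- by move=> *; rewrite add0r.
- by move=> *; rewrite addNr.
- by move=> *; rewrite scalerA.
- by move=> *; rewrite scale1r.
- by move=> *; rewrite scalerDr.
- by move=> *; rewrite scalerDl.
- by move=> v w; rewrite V1; case: ifP.
- by move=> e; case: (V2 e).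
- by move=> e; case: (V2 e).
- by move=> e; case: (V2 e).
- by move=> e; case: (V2 e).
- by move=> e g; rewrite V3; case: ifP.
- move=> u ureg; rewrite V4 // fsbig_finite; last by case: ureg.
  by apply: (big_rec2 (fun x y => x = eval y)) => // e x y _ ->.
Qed.

Lemma lpa_universal : exists! h : lpa -> A,
  [/\ linear h, {morph h : x y / lpa_mul x y >-> mul x y},
      forall v, h (lpa_vertex v) = V v, forall e, h (lpa_edge e) = X e &
      forall e, h (lpa_ghost e) = Y e].
Proof.
pose h (x : lpa) := eval (repr x).
have hE a : h (cls a) = eval a by exact/eval_teq/teq_repr.
exists h; split; first split.
- move=> k; elim/lpaW=> a; elim/lpaW=> b.
  by rewrite lpa_scaleE lpa_addE !hE.
- by elim/lpaW=> a; elim/lpaW=> b; rewrite lpa_mulE !hE.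
- by move=> v; rewrite hE.
- by move=> e; rewrite hE.
- by move=> e; rewrite hE.
move=> g [glin gM gV gX gY]; apply/funext.
have g0 : g 0 = 0.
  by have := glin (-1) 0 0; rewrite scaler0 add0r scaleN1r addNr.
have gZ k x : g (k *: x) = k *: g x.
  by have := glin k x 0; rewrite !addr0 g0 addr0.
have gN x : g (- x) = - g x by rewrite -(scaleN1r x) gZ scaleN1r.
have gD x y : g (x + y) = g x + g y.
  by have := glin 1 x y; rewrite !scale1r.
elim/lpaW; elim=> [v|e|e||a IH|a IHa b IHb|k a IH|a IHa b IHb]; rewrite hE /=.
- by rewrite -gV.
- by rewrite -gX.
- by rewrite -gY.
- by rewrite -lpa_zeroE.
- by rewrite -lpa_oppE gN -IH hE.
- by rewrite -lpa_addE gD -IHa -IHb !hE.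
- by rewrite -lpa_scaleE gZ -IH hE.
- by rewrite -lpa_mulE gM -IHa -IHb !hE.
Qed.

End Universal.

End LeavittPathAlgebra.

(* The saturated function attached to an ideal I of L_R(E), given by its      *)
(* values as subsets of R.                                                    *)
Definition ideal_function (R : comPzRingType) (E : graph) (I : set (lpa R E))
    (H : set (vertex E)) : set R :=
  [set r | forall v, H v -> I (r *: lpa_vertex R v)].

Definition corresponds (R : comPzRingType) (E : graph) (I : set (lpa R E))
    (f : Tstar E -> ideals ( *%R : R -> R -> R)) : Prop :=
  forall H : Tstar E, set_val (f H) = ideal_function I (set_val H).

(* Main.v *)
(* Suppose J1 J2 is contained in f(H). The elements y of L_R(E) with
   J1 y <= I form an ideal K2 containing J2 H, and the left annihilator K1 of
   K2 modulo I is an ideal containing J1 H, because (r v) y = v (r y). Since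
   K1 K2 <= I, primality of I puts J1 H or J2 H inside I. *)
Require Import Defs.
From mathcomp Require Import all_boot all_algebra.
From mathcomp Require Import boolp classical_sets functions.
Local Open Scope classical_set_scope.
Local Open Scope ring_scope.
Import GRing.Theory.

Lemma ideal_sum (A : zmodType) (mul : A -> A -> A) (I : set A) (T : eqType)
    (s : seq T) (F : T -> A) :
  ideal mul I -> (forall t, t \in s -> I (F t)) -> I (\sum_(t <- s) F t).
Proof.
move=> [I0 IB _ _] IF; rewrite big_seq; apply: big_ind => // x y Ix Iy.
by rewrite -(opprK y); apply: (IB) => //; rewrite -(sub0r y); apply: IB.
Qed.

Lemma ideal_scaler_colon (R : comPzRingType) (A : lmodType R)
    (mul : A -> A -> A) (I : set A) (J : set R) :
  algebra_law mul -> ideal mul I ->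
  ideal mul [set x | forall r, J r -> I (r *: x)].
Proof.
move=> [_ _ _ scalel scaler] [I0 IB IMl IMr]; split=> /=.
- by move=> r _; rewrite scaler0.
- by move=> x y Ix Iy r Jr; rewrite scalerBr; apply: IB; [apply: Ix|apply: Iy].
- by move=> a x Ix r Jr; rewrite -scaler; apply/IMl/Ix.
- by move=> a x Ix r Jr; rewrite -scalel; apply/IMr/Ix.
Qed.

(** Stability under right multiplication uses that [K] absorbs left factors: [(x a) y = x (a y)]
    with [a y] again in [K]. *)
Lemma ideal_left_colon (R : comPzRingType) (A : lmodType R)
    (mul : A -> A -> A) (I K : set A) :
  algebra_law mul -> ideal mul I -> ideal mul K ->
  ideal mul [set x | forall y, K y -> I (mul x y)].
Proof.
move=> [mulA mulDl _ scalel _] [I0 IB IMl IMr] [_ _ KMl _]; split=> /=.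
(* Zero and opposites pass through [mul] as the scalars [0] and [-1]. *)
- by move=> y _; rewrite -(scale0r 0) scalel scale0r.
- move=> x z Ix Iz y Ky; rewrite mulDl -scaleN1r scalel scaleN1r.
  by apply: IB; [apply: Ix|apply: Iz].
- by move=> a x Ix y Ky; rewrite -mulA; apply/IMl/Ix.
- by move=> a x Ix y Ky; rewrite -mulA; apply/Ix/KMl.
Qed.

(** Colon ideals replace the ideals generated by [J1 V] and [J2 V], so no explicit form of generated
    elements is needed in the non-unital [A]. *)
Lemma prime_ideal_scaler (R : comPzRingType) (A : lmodType R)
    (mul : A -> A -> A) (I V : set A) (J1 J2 : set R) :
  algebra_law mul -> prime_ideal mul I ->
  (forall r s v, J1 r -> J2 s -> V v -> I ((r * s) *: v)) ->
  (forall r v, J1 r -> V v -> I (r *: v)) \/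
  (forall s v, J2 s -> V v -> I (s *: v)).
Proof.
move=> algA [idI _ primeI] J12V.
have [_ _ _ scalel scaler] := algA; have [_ _ IMl _] := idI.
pose K2 : set A := [set y | forall r, J1 r -> I (r *: y)].
pose K1 : set A := [set x | forall y, K2 y -> I (mul x y)].
have idK2 : ideal mul K2 by exact: ideal_scaler_colon.
have idK1 : ideal mul K1 by exact: ideal_left_colon.
have K12 : ideal_prod mul K1 K2 `<=` I.
  move=> _ [s sK ->]; apply: ideal_sum idI _ => p /sK[K1p K2p].
  exact: K1p.
case: (primeI K1 K2 idK1 idK2 K12) => KI; [left=> r v J1r Vv|right=> s v J2s Vv].
  by apply: KI => y K2y; rewrite scalel -scaler; apply/IMl/K2y.
by apply: KI => r J1r; rewrite scalerA; apply: J12V.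
Qed.

Theorem lemma6p31 (R : comPzRingType) (E : graph)
    (row_finite_E : row_finite E) (C_u_empty : C_u E = set0)
    (f : Tstar E -> ideals ( *%R : R -> R -> R))
    (f_saturated : saturated_function f)
    (I : set (lpa R E)) (I_ideal : ideal (@lpa_mul R E) I)
    (I_f : corresponds I f)
    (I_prime : prime_ideal (@lpa_mul R E) I) :
  forall H : Tstar E, (Spec R `|` [set setT]) (set_val (f H)).
Proof.
(* The value [R] is set apart because a prime ideal must be proper. *)
move=> H; have [fHT|fHT] := pselect (set_val (f H) = setT); first by right.
left; split=> //; first exact: (set_valP (f H)).
move=> J1 J2 _ _ J12; rewrite I_f in J12 *.
have J12V r s v : J1 r -> J2 s -> (@lpa_vertex R E @` set_val H) v ->
    I ((r * s) *: v).
  move=> J1r J2s [w Hw <-]; apply: (J12 (r * s)) => //.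
  (* The product [r * s] is a one-term sum in [ideal_prod]. *)
  by exists [:: (r, s)]; [move=> p; rewrite inE => /eqP->|rewrite big_seq1].
have [IJ|IJ] := prime_ideal_scaler _ _ _ _ _ _ _ (lpa_algebra R E) I_prime J12V.
- by left=> r J1r v Hv; apply: IJ => //; exists v.
- by right=> r J2r v Hv; apply: IJ => //; exists v.
Qed.
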